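(* The set $LC_2=\{xI+yE : x,y\in\mathbb{R}\}$ of operators on $\mathbb{P}_2$, with the addition $(x_1I+y_1E)+(x_2I+y_2E)=(x_1+x_2)I+(y_1+y_2)E$, the scalar multiplication $c(xI+yE)=cxI+cyE$ ($c\in\mathbb{R}$), and the multiplication $(x_1I+y_1E)(x_2I+y_2E)=(x_1x_2+y_1y_2)I+(x_1y_2+x_2y_1)E$, is a commutative algebra over $\mathbb{R}$ with unity.
   Context: $\mathbb{P}_2$ is the real vector space of all functions $f:\mathbb{R}\to\mathbb{R}$ with $f(t+2)=f(t)$ for all $t\in\mathbb{R}$. $I$ is the identity operator on $\mathbb{P}_2$ and $E$ is the unit shift operator $(Ef)(t)=f(t+1)$ on $\mathbb{P}_2$, so that $E^2=I$. An algebra over $\mathbb{R}$ is a real vector space $X$ with a multiplication $X\times X\to X$ that is associative, left and right distributive over addition, and satisfies $(aL)(bM)=ab(LM)$ for $a,b\in\mathbb{R}$, $L,M\in X$. It is commutative if its multiplication is commutative, and it has a unity if there is a nonzero $J\in X$ with $LJ=JL=L$ for all $L\in X$. *)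

(* Defs.v *)
From HB Require Import structures.
From mathcomp Require Import all_boot all_order all_algebra.
From mathcomp Require Import mathcomp_extra boolp classical_sets functions reals.

Set Implicit Arguments.
Unset Strict Implicit.
Unset Printing Implicit Defensive.

Import Order.TTheory GRing.Theory Num.Theory.

Local Open Scope classical_set_scope.
Local Open Scope ring_scope.

Section PeriodTwo.
Variable R : realType.

(* The codomain is [R^o], i.e. R as a vector space over itself, so that
   [R -> R^o] carries the pointwise vector space structure of functions. *)
Definition period2 : {pred (R -> R^o)} :=
  fun f => `[< forall t : R, f (t + 2) = f t >].

Lemma period2_submod_closed : submod_closed period2.
Proof.
split=> [|a f g /asboolP Hf /asboolP Hg]; first exact/asboolP.
apply/asboolP => t.
by rewrite [LHS]/(a * f (t + 2) + g (t + 2)) Hf Hg.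
Qed.

HB.instance Definition _ :=
  GRing.isSubmodClosed.Build R (R -> R^o) period2 period2_submod_closed.

Record P2 := MkP2 { P2_fun :> R -> R^o; P2_funP : P2_fun \in period2 }.

HB.instance Definition _ := [isSub for P2_fun].
HB.instance Definition _ := [Choice of P2 by <:].
HB.instance Definition _ := [SubChoice_isSubLmodule of P2 by <:].

Lemma shift_period2 (f : P2) : (fun t : R => f (t + 1)) \in period2.
Proof.
by apply/asboolP => t; rewrite addrAC; have /asboolP -> := P2_funP f.
Qed.

Definition I2 : P2 -> P2 := fun f => f.
Definition E2 : P2 -> P2 := fun f => MkP2 (shift_period2 f).

(* [P2 -> P2] carries the pointwise vector space structure of operators. *)
Definition LC2 : set (P2 -> P2) :=
  [set L | exists x y : R, L = x *: I2 + y *: E2].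

Lemma lc2_subproof (x y : R) : x *: I2 + y *: E2 \in LC2.
Proof. by apply/mem_set; exists x, y. Qed.

Definition lc2 (x y : R) : LC2 := SigSub (lc2_subproof x y).

End PeriodTwo.

Arguments LC2 R : clear implicits.

(* Main.v *)
Require Import Defs.
From HB Require Import structures.
From mathcomp Require Import all_boot all_order all_algebra.
From mathcomp Require Import mathcomp_extra boolp classical_sets functions reals.
From mathcomp Require Import ring.

Set Implicit Arguments.
Unset Strict Implicit.
Unset Printing Implicit Defensive.

Import Order.TTheory GRing.Theory Num.Theory.

Local Open Scope classical_set_scope.
Local Open Scope ring_scope.

(** The operations are given by formulas in the coefficients of
    [x I + y E], so they are well defined on operators only because [I] and
    [E] are linearly independent. One function witnesses the independence:
    the sawtooth [s] of period 2 with [s t = t] for [0 <= t < 2]. Since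
    [s 0 = 0] and [s 1 = 1], the operator [x I + y E] sends [s] to a function
    with value [y] at 0 and [x] at 1, so both coefficients can be read off the
    operator ([coefI_lc2], [coefE_lc2]). The operators thus correspond
    bijectively to pairs of reals, and each equational axiom becomes a pair of
    polynomial identities in the coefficients ([eq_coef]). The multiplication
    is that of [R[E]] modulo [E^2 = 1]. Its unity is [I = 1 I + 0 E], which
    differs from 0 because its first coefficient is 1. *)

Section LC2Algebra.
Variable R : realType.
Implicit Types (c x y : R) (L M N : LC2 R).

Lemma sawtooth_period2 :
  (fun t : R => t - 2 * (Num.floor (t / 2))%:~R : R^o) \in @period2 R.
Proof.
apply/asboolP => t.
have -> : (t + 2) / 2 = t / 2 + 1 by field.
by rewrite floorDrz ?int_num1// floor1 intrD; ring.
Qed.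

Definition sawtooth : P2 R := MkP2 sawtooth_period2.

Lemma sawtooth0 : sawtooth 0 = 0.
Proof. by rewrite /= mul0r floor0 mulr0 subr0. Qed.

Lemma sawtooth1 : sawtooth 1 = 1.
Proof.
have /= -> : Num.floor (1 / 2 : R) = 0; last by rewrite mulr0 subr0.
apply/floor_def; rewrite add0r div1r invr_ge0 ler0n/=.
by rewrite invf_lt1 ?ltr0n// ltr1n.
Qed.

Lemma sawtooth2 : sawtooth (1 + 1) = 0.
Proof.
have /asboolP/(_ 0) := P2_funP sawtooth.
by rewrite add0r sawtooth0 -[2]/(1 + 1).
Qed.

(** The operator [x I + y E] maps the sawtooth [s] to [t |-> x s(t) + y s(t+1)],
    so the coefficient of [I] appears at 1, where [s(t+1)] vanishes, and that
    of [E] at 0, where [s(t)] vanishes. *)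
Definition coefI L : R := val L sawtooth 1.
Definition coefE L : R := val L sawtooth 0.

Lemma lc2_apply x y (f : P2 R) t :
  val (lc2 x y) f t = x * f t + y * f (t + 1).
Proof. by []. Qed.

Lemma coefI_lc2 x y : coefI (lc2 x y) = x.
Proof.
by rewrite /coefI lc2_apply sawtooth1 sawtooth2 mulr1 mulr0 addr0.
Qed.

Lemma coefE_lc2 x y : coefE (lc2 x y) = y.
Proof.
by rewrite /coefE lc2_apply add0r sawtooth0 sawtooth1 mulr0 mulr1 add0r.
Qed.

Lemma lc2_of_coef L : lc2 (coefI L) (coefE L) = L.
Proof.
suff [x [y ->]] : exists x y, L = lc2 x y by rewrite coefI_lc2 coefE_lc2.
by have /set_mem[x [y Lxy]] := valP L; exists x, y; exact: val_inj.
Qed.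

Definition addLC L M := lc2 (coefI L + coefI M) (coefE L + coefE M).
Definition oppLC L := lc2 (- coefI L) (- coefE L).
Definition scaleLC c L := lc2 (c * coefI L) (c * coefE L).
Definition mulLC L M :=
  lc2 (coefI L * coefI M + coefE L * coefE M)
      (coefI L * coefE M + coefI M * coefE L).

Definition coefs := (coefI_lc2, coefE_lc2).

(** Every element of [LC2 R] is some [lc2 x y], and [x] and [y] are recovered
    by evaluation at the sawtooth; this turns each equation between operators
    into two equations between reals. *)
Lemma eq_coef L M : coefI L = coefI M -> coefE L = coefE M -> L = M.
Proof. by rewrite -[L]lc2_of_coef -[M]lc2_of_coef !coefs => -> ->. Qed.

(** The carrier under its own name, which keys the algebra instances on
    this type alone instead of on all subtypes. *)
Definition LC2_algebra : Type := LC2 R.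

HB.instance Definition _ :=
  Choice.copy LC2_algebra {L : P2 R -> P2 R | L \in LC2 R}.

Lemma addLCA : associative addLC.
Proof. by move=> L M N; apply: eq_coef; rewrite !coefs addrA. Qed.

Lemma addLCC : commutative addLC.
Proof. by move=> L M; apply: eq_coef; rewrite !coefs addrC. Qed.

Lemma add0LC : left_id (lc2 0 0) addLC.
Proof. by move=> L; apply: eq_coef; rewrite !coefs add0r. Qed.

Lemma addNLC : left_inverse (lc2 0 0) oppLC addLC.
Proof. by move=> L; apply: eq_coef; rewrite !coefs addNr. Qed.

HB.instance Definition _ :=
  GRing.isZmodule.Build LC2_algebra addLCA addLCC add0LC addNLC.

Lemma mulLCA : associative mulLC.
Proof. by move=> L M N; apply: eq_coef; rewrite !coefs; ring. Qed.

Lemma mulLCC : commutative mulLC.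
Proof. by move=> L M; apply: eq_coef; rewrite !coefs; ring. Qed.

Lemma mul1LC : left_id (lc2 1 0) mulLC.
Proof. by move=> L; apply: eq_coef; rewrite !coefs; ring. Qed.

Lemma mulLCDl : left_distributive mulLC addLC.
Proof. by move=> L M N; apply: eq_coef; rewrite !coefs; ring. Qed.

Lemma unityLC_neq0 : lc2 1 0 != lc2 0 0 :> LC2 R.
Proof.
apply/eqP => /(congr1 coefI); rewrite !coefs => /eqP.
by rewrite oner_eq0.
Qed.

HB.instance Definition _ := GRing.Zmodule_isComNzRing.Build LC2_algebra
  mulLCA mulLCC mul1LC mulLCDl unityLC_neq0.

Lemma scaleLCA c d L : scaleLC c (scaleLC d L) = scaleLC (c * d) L.
Proof. by apply: eq_coef; rewrite !coefs mulrA. Qed.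

Lemma scale1LC : left_id 1 scaleLC.
Proof. by move=> L; apply: eq_coef; rewrite !coefs mul1r. Qed.

Lemma scaleLCDr : right_distributive scaleLC addLC.
Proof. by move=> c L M; apply: eq_coef; rewrite !coefs mulrDr. Qed.

Lemma scaleLCDl L : {morph scaleLC^~ L : c d / c + d >-> addLC c d}.
Proof. by move=> c d; apply: eq_coef; rewrite !coefs mulrDl. Qed.

HB.instance Definition _ := GRing.Zmodule_isLmodule.Build R LC2_algebra
  scaleLCA scale1LC scaleLCDr scaleLCDl.

Lemma scaleLCAl c L M : scaleLC c (mulLC L M) = mulLC (scaleLC c L) M.
Proof. by apply: eq_coef; rewrite !coefs; ring. Qed.

HB.instance Definition _ :=
  GRing.Lmodule_isLalgebra.Build R LC2_algebra scaleLCAl.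

HB.instance Definition _ := GRing.Lalgebra_isComAlgebra.Build R LC2_algebra.

End LC2Algebra.

Theorem theorem2p6 (R : realType) :
  exists algLC2 : GRing.ComAlgebra R (LC2 R),
    let A : comAlgType R := GRing.ComAlgebra.Pack algLC2 in
    [/\ forall x1 y1 x2 y2 : R,
          (lc2 x1 y1 : A) + (lc2 x2 y2 : A) = lc2 (x1 + x2) (y1 + y2),
        forall c x y : R,
          c *: (lc2 x y : A) = lc2 (c * x) (c * y)
      & forall x1 y1 x2 y2 : R,
          (lc2 x1 y1 : A) * (lc2 x2 y2 : A)
            = lc2 (x1 * x2 + y1 * y2) (x1 * y2 + x2 * y1)].
Proof.
exists (GRing.ComAlgebra.class (LC2_algebra R)) => A.
by split=> *; apply: eq_coef; rewrite !coefs.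
Qed.
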